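(* Let $(\Omega,\mu)$ be a finite probability space, $0<\rho\le1/3$, $q\ge2$, and $f\colon\Omega^n\to\mathbb{R}$. Then \[\|T_{\rho/\sqrt q}f\|_q^q\le\sum_{S\subseteq[n]}\beta^{q|S|}q^{-q|S|/2}\,\mathbb{E}_{x\sim\mu^S}\|D_{S,x}f\|_2^q,\] where $\beta=\rho\left(1+\frac{2(q-2)}{\log(1/\rho)}\right)$.
   Context: Norms w.r.t. $\mu^n$ (over remaining coordinates for $D_{S,x}f$); $\log$ natural. $T_\rho f(x)=\mathbb{E}_y f(y)$ where $y$ keeps each $x_i$ independently with probability $\rho$ and otherwise resamples it from $\mu$. For $i\in[n]$, $E_i$ averages over coordinate $i$ according to $\mu$, $L_i=I-E_i$, $L_S=\prod_{i\in S}L_i$, and $D_{S,x}f=(L_Sf)_{S\to x}$, where $h_{S\to x}(y)=h(x,y)$. *)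

(* Defs.v *)
From HB Require Import structures.
From mathcomp Require Import all_boot all_order all_algebra.
From mathcomp Require Import reals exp.
Set Implicit Arguments. Unset Strict Implicit. Unset Printing Implicit Defensive.
Import Order.TTheory GRing.Theory Num.Theory.
Local Open Scope ring_scope.

Section Defs.
Variables (R : realType) (Omega : finType) (mu : Omega -> R) (n : nat).

Definition pt := {ffun 'I_n -> Omega}.

Definition wt (A : {set 'I_n}) (x : pt) : R := \prod_(i in A) mu (x i).

Definition Emu (g : pt -> R) : R := \sum_(x : pt) wt setT x * g x.

(* noise operator: y_i = x_i w.p. rho, otherwise resampled from mu *)
Definition Trho (rho : R) (f : pt -> R) (x : pt) : R :=
  \sum_(y : pt) (\prod_(i < n) (rho * (x i == y i)%:R + (1 - rho) * mu (y i))) * f y.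

Definition upd (x : pt) (i : 'I_n) (a : Omega) : pt :=
  [ffun j => if j == i then a else x j].

Definition Ei (i : 'I_n) (f : pt -> R) (x : pt) : R := \sum_(a : Omega) mu a * f (upd x i a).
Definition Li (i : 'I_n) (f : pt -> R) (x : pt) : R := f x - Ei i f x.
Definition LS (S : {set 'I_n}) (f : pt -> R) : pt -> R := foldr Li f (enum S).

Definition ptIn (S : {set 'I_n}) := {ffun {i : 'I_n | i \in S} -> Omega}.
Definition ptOut (S : {set 'I_n}) := {ffun {i : 'I_n | i \notin S} -> Omega}.

Definition merge (S : {set 'I_n}) (x : ptIn S) (y : ptOut S) : pt :=
  [ffun i => match boolP (i \in S) with
             | AltTrue h => x (exist _ i h)
             | AltFalse h => y (exist _ i h)
             end].

Definition DS (S : {set 'I_n}) (x : ptIn S) (f : pt -> R) (y : ptOut S) : R :=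
  LS S f (merge x y).

Definition norm2Out (S : {set 'I_n}) (g : ptOut S -> R) : R :=
  Num.sqrt (\sum_(y : ptOut S) (\prod_(i : {i : 'I_n | i \notin S}) mu (y i)) * g y ^+ 2).

Definition EIn (S : {set 'I_n}) (g : ptIn S -> R) : R :=
  \sum_(x : ptIn S) (\prod_(i : {i : 'I_n | i \in S}) mu (x i)) * g x.

End Defs.

(* Main.v *)
(** Write r = rho / sqrt q, c = (beta / sqrt q)^q and let T_i = E_i + r L_i be the
noise operator on coordinate i.  For i outside A,
  E (E_A (T_i g)^2)^(q/2)
    <= E (E_{A+i} g^2)^(q/2) + c E (E_A (L_i g)^2)^(q/2);
applying this to the coordinates one after another, and using that L_i commutes
with the remaining noise, turns E |T f|^q into the sum over S of
c^|S| E (E_{S^c} (L_S f)^2)^(q/2).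

In the one-coordinate step, a = E_i g does not depend on x_i and h = L_i g has mean
zero in x_i, so by Cauchy-Schwarz for E_A it suffices to bound the average of
(1 + 2 r u + r^2 w)^(q/2) when u has mean zero and u^2 <= w.  Convexity in u reduces
the pointwise bound 1 + q r u + (q/2) w + c w^(q/2) to the extreme points u = +- sqrt w,
that is, with t = r sqrt w and K = beta / rho, to
  |1 +- t|^q <= 1 +- q t + q^2 t^2 / (2 rho^2) + (K t)^q,
and Bernoulli's inequality (1 + W)^(q/2) >= 1 + (q/2) W recombines the main terms. *)

Require Import Defs.
From HB Require Import structures.
From mathcomp Require Import all_boot all_order all_algebra.
From mathcomp Require Import reals exp.
From mathcomp Require Import boolp ring lra.
Import Order.TTheory GRing.Theory Num.Theory.
Local Open Scope ring_scope.

(** * Scalar inequalities *)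

(** Young's inequality for the product [z * 1] with exponent [s] and its conjugate. The case
    [s = 1], where the conjugate is infinite, is separate. *)
Lemma powR_Bernoulli (R : realType) (s z : R) :
  1 <= s -> 0 <= z -> 1 + s * (z - 1) <= powR z s.
Proof.
rewrite le_eqVlt => /orP[/eqP <- z0|s1 z0]; first by rewrite powRr1 //; lra.
have s0 : 0 < s by lra.
have t0 : 0 < 1 - s^-1 by rewrite subr_gt0 invf_lt1.
have := @conjugate_powR R z 1 s (1 - s^-1)^-1 z0 ler01 s0.
rewrite invr_gt0 invrK powR1 subrKC => /(_ t0 erefl).
rewrite -(ler_pM2l s0).
set w := powR z s.
have -> : s * (w / s + 1 * (1 - s^-1)) = w + s - 1 by field; lra.
by lra.
Qed.

Lemma powR_tangent (R : realType) (s x y : R) :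
  1 <= s -> 0 <= x -> 0 <= y ->
  powR x s + s * powR x (s - 1) * (y - x) <= powR y s.
Proof.
move=> s1; rewrite le_eqVlt => /orP[/eqP <- y0|x0 y0].
  (* At [x = 0] the exponent [s = 1] stands apart, because [powR 0 0] is [1]. *)
  have [->|s_ne1] := eqVneq s 1.
    by rewrite subrr powRr0 !powRr1 //; lra.
  rewrite !powR0; [|lra|lra].
  by rewrite mulr0 mul0r addr0 powR_ge0.
have yx0 : 0 <= y / x by rewrite divr_ge0 // ltW.
have xs0 : 0 <= powR x s := powR_ge0 _ _.
have := ler_wpM2l xs0 (powR_Bernoulli _ _ _ s1 yx0).
rewrite -powRM // ?(ltW x0) //.
have -> : x * (y / x) = y by field; lra.
apply: le_trans; rewrite -(mulr_powRB1 (ltW x0)) ?(lt_le_trans ltr01) //.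
rewrite le_eqVlt; apply/orP; left; apply/eqP; field; lra.
Qed.

(** The ratio [K = beta / rho]. *)
Definition noise_scale {R : realType} (rho q : R) : R := 1 + 2 * (q - 2) / ln (1 / rho).

Lemma ln_inv_gt0 (R : realType) (rho : R) :
  0 < rho -> rho <= 1 / 3 -> 0 < ln (1 / rho).
Proof. by move=> rho_gt0 rho_le; apply: ln_gt0; rewrite ltr_pdivlMr //; lra. Qed.

Lemma scale_ge1 (R : realType) (rho q : R) :
  0 < rho -> rho <= 1 / 3 -> 2 <= q -> 1 <= noise_scale rho q.
Proof.
move=> rho_gt0 rho_le q_ge2.
rewrite /noise_scale lerDl divr_ge0 //; first by lra.
exact/ltW/ln_inv_gt0.
Qed.

Lemma inv_ge3 (R : realType) (rho : R) : 0 < rho -> rho <= 1 / 3 -> 3 <= 1 / rho.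
Proof. by move=> rho_gt0 rho_le; rewrite ler_pdivlMr //; lra. Qed.

Lemma powR_add1_le (R : realType) (rho q t : R) :
  0 < rho -> rho <= 1 / 3 -> 2 <= q -> 0 <= t ->
  powR (1 + t) q <= 1 + q * t + q ^+ 2 * t ^+ 2 / (2 * rho ^+ 2) + powR (noise_scale rho q * t) q.
Proof.
move=> rho_gt0 rho_le q_ge2 t0; set L := ln (1 / rho); set K := noise_scale rho q.
have L_gt0 : 0 < L by exact: ln_inv_gt0.
have Kt0 := powR_ge0 (K * t) q.
have q2 : q ^+ 2 * t ^+ 2 / (2 * rho ^+ 2) =
  q ^+ 2 * t ^+ 2 / 2 * (1 / rho) ^+ 2 by field; lra.
(* If [(1 + t)^(q-2) <= 1/rho] the quadratic term wins; otherwise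
   [(q - 2) t > ln (1/rho)], so that [1 + t <= K t]. *)
have [small|large] := leP (powR (1 + t) (q - 2)) (1 / rho).
  (* Tangents at [1 + t], evaluated at [1], bound powers from above:
     [(1 + t)^q <= 1 + q t (1 + t)^(q-1)], and likewise for the exponent [q - 1]. *)
  have h1 := powR_tangent _ q (1 + t) 1 ltac:(lra) ltac:(lra) ler01.
  have h2 := powR_tangent _ (q - 1) (1 + t) 1 ltac:(lra) ltac:(lra) ler01.
  rewrite !powR1 in h1 h2.
  have e : q - 1 - 1 = q - 2 by ring.
  rewrite e in h2; rewrite q2.
  move: small h1 h2 (inv_ge3 _ _ rho_gt0 rho_le).
  set a := powR _ (q - 2); set b := powR _ (q - 1); set c := powR _ q.
  set i := 1 / rho => small h1 h2 i3.
  have h3 : b <= 1 + (q - 1) * t * a by lra.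
  have h4 : (q - 1) * t * a <= (q - 1) * t * i.
    by apply: ler_wpM2l => //; apply: mulr_ge0; lra.
  have h5 : q * t * b <= q * t * (1 + (q - 1) * t * i).
    by apply: ler_wpM2l; [apply: mulr_ge0; lra|lra].
  have tt : 0 <= t ^+ 2 := sqr_ge0 _.
  have h6 : q * (q - 1) * i <= q ^+ 2 / 2 * i ^+ 2.
    have : 0 <= (q * i) * (q * i / 2 - (q - 1)).
      by apply: mulr_ge0; [apply: mulr_ge0; lra| nra].
    by lra.
  have h7 := ler_wpM2r tt h6.
  by nra.
have large' : L < (q - 2) * ln (1 + t).
  rewrite -ln_powR ltr_ln // posrE; first by rewrite divr_gt0.
  by apply: powR_gt0; lra.
have lt : ln (1 + t) <= t by apply: le_ln1Dx; lra.
have lt' : (q - 2) * ln (1 + t) <= (q - 2) * t by apply: ler_wpM2l => //; lra.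
have h : 1 + t <= K * t.
  have : 1 <= (q - 2) * t / L by rewrite ler_pdivlMr //; lra.
  rewrite /K /noise_scale -/L; lra.
have := @ge0_ler_powR R q ltac:(lra) (1 + t) (K * t).
rewrite !nnegrE => /(_ ltac:(lra) ltac:(lra) h).
have : 0 <= q ^+ 2 * t ^+ 2 / (2 * rho ^+ 2).
  by apply: divr_ge0; apply: mulr_ge0; rewrite ?sqr_ge0.
have : 0 <= q * t by apply: mulr_ge0; lra.
by lra.
Qed.

Lemma powR_sub1_le (R : realType) (rho q t : R) :
  0 < rho -> rho <= 1 / 3 -> 2 <= q -> 0 <= t ->
  powR `|1 - t| q <= 1 - q * t + q ^+ 2 * t ^+ 2 / (2 * rho ^+ 2) + powR (noise_scale rho q * t) q.
Proof.
move=> rho_gt0 rho_le q_ge2 t0; set K := noise_scale rho q.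
have K_ge1 : 1 <= K by exact: scale_ge1.
have Kt0 := powR_ge0 (K * t) q.
have q2 : q ^+ 2 * t ^+ 2 / (2 * rho ^+ 2) =
  q ^+ 2 * t ^+ 2 / 2 * (1 / rho) ^+ 2 by field; lra.
have qt0 : 0 <= q ^+ 2 * t ^+ 2 / 2 by apply: divr_ge0 => //; apply: mulr_ge0; rewrite sqr_ge0.
have i9 : 9 <= (1 / rho) ^+ 2 by move: (inv_ge3 _ _ rho_gt0 rho_le); set i := 1 / rho; nra.
have h9 := ler_wpM2l qt0 i9.
rewrite q2.
have [t1|t1] := leP t 1.
  rewrite ger0_norm ?subr_ge0 //.
  (* The tangent at [1 - t] and Bernoulli for [(1 - t)^(q-1)] give [1 - q t + q (q-1) t^2]; the
     factor [1 / rho^2 >= 9] absorbs the last term. *)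
  have h1 := powR_tangent _ q (1 - t) 1 ltac:(lra) ltac:(lra) ler01.
  have h2 := powR_Bernoulli _ (q - 1) (1 - t) ltac:(lra) ltac:(lra).
  rewrite powR1 in h1.
  move: h1 h2; set b := powR _ (q - 1); set c := powR _ q => h1 h2.
  have h5 : q * t * (1 - (q - 1) * t) <= q * t * b.
    by apply: ler_wpM2l; [apply: mulr_ge0; lra|lra].
  have h6 : 0 <= q * t ^+ 2 by rewrite mulr_ge0 ?sqr_ge0 //; lra.
  by nra.
(* For [t > 1] the term [(K t)^q] dominates alone, and [(1 - q t)^2 >= 0] keeps the other terms
   nonnegative. *)
rewrite ltr0_norm ?subr_lt0 //.
have h : - (1 - t) <= K * t by nra.
have := @ge0_ler_powR R q ltac:(lra) (- (1 - t)) (K * t).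
rewrite !nnegrE => /(_ ltac:(lra) ltac:(nra) h).
have : 0 <= (1 - q * t) ^+ 2 := sqr_ge0 _.
by nra.
Qed.

(** In the weighted average of the tangent bounds at the mean [z], the linear terms cancel. *)
Lemma powR_convex (R : realType) (s th x y : R) :
  1 <= s -> 0 <= th <= 1 -> 0 <= x -> 0 <= y ->
  powR (th * x + (1 - th) * y) s <= th * powR x s + (1 - th) * powR y s.
Proof.
move=> s1 /andP[th0 th1] x0 y0; set z := _ + _.
have z0 : 0 <= z by apply: addr_ge0; apply: mulr_ge0 => //; lra.
have h1 := ler_wpM2l th0 (powR_tangent _ _ _ _ s1 z0 x0).
have h2 : 0 <= 1 - th by lra.
have h3 := ler_wpM2l h2 (powR_tangent _ _ _ _ s1 z0 y0).
apply: le_trans (lerD h1 h3); rewrite le_eqVlt; apply/orP; left.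
by apply/eqP; rewrite /z; ring.
Qed.

Lemma powR_sqr_half (R : realType) (q x : R) : powR (x ^+ 2) (q / 2) = powR `|x| q.
Proof.
rewrite -real_normK ?num_real // -powR_mulrn // -powRrM.
by congr powR; field.
Qed.

Lemma noise_pointwise (R : realType) (rho q u w : R) :
  0 < rho -> rho <= 1 / 3 -> 2 <= q -> 0 <= w -> u ^+ 2 <= w ->
  let r := rho / Num.sqrt q in
  powR (1 + 2 * r * u + r ^+ 2 * w) (q / 2)
  <= 1 + q * r * u + q / 2 * w
     + powR (rho * noise_scale rho q / Num.sqrt q) q * powR w (q / 2).
Proof.
move=> rho_gt0 rho_le q_ge2 w0 uw; set r := rho / _; cbv zeta.
have q0 : 0 < q by lra.
have sq0 : 0 < Num.sqrt q by rewrite sqrtr_gt0.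
have sqq : Num.sqrt q ^+ 2 = q by rewrite sqr_sqrtr // ltW.
have r0 : 0 < r by rewrite divr_gt0.
set v := Num.sqrt w; have v0 : 0 <= v := sqrtr_ge0 _.
have vw : v ^+ 2 = w by rewrite sqr_sqrtr.
have : `|u| <= v by rewrite -sqrtr_sqr ler_wsqrtr.
rewrite ler_norml => /andP[vu uv].
(* [1 + 2ru + r^2 w] is the [th]-average of [(1 + rv)^2] and [(1 - rv)^2];
   for [v = 0], [u / v = 0] makes this hold with [th = 1/2]. *)
pose th := (1 + u / v) / 2.
have uvK : v * (u / v) = u.
  have [v_eq0|v_ne0] := eqVneq v 0; last by field.
  by rewrite v_eq0 mul0r; lra.
have th01 : 0 <= th <= 1.
  have [v_eq0|v_ne0] := eqVneq v 0.
    by rewrite /th v_eq0 invr0 mulr0; lra.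
  have v_gt0 : 0 < v by rewrite lt0r v_ne0.
  have : -1 <= u / v by rewrite ler_pdivlMr //; lra.
  have : u / v <= 1 by rewrite ler_pdivrMr //; lra.
  by rewrite /th; lra.
have -> : 1 + 2 * r * u + r ^+ 2 * w =
    th * (1 + r * v) ^+ 2 + (1 - th) * (1 - r * v) ^+ 2.
  have -> : th * (1 + r * v) ^+ 2 + (1 - th) * (1 - r * v) ^+ 2 =
    1 + 2 * r * (v * (u / v)) + r ^+ 2 * v ^+ 2 by rewrite /th; move: (u / v) => z; field.
  by rewrite uvK vw.
have p1 : 1 <= q / 2 by lra.
apply: le_trans (powR_convex _ _ _ _ _ p1 th01 (sqr_ge0 _) (sqr_ge0 _)) _.
have rv0 : 0 <= r * v by rewrite mulr_ge0 // ltW.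
rewrite !powR_sqr_half (ger0_norm (_ : 0 <= 1 + r * v)) ?addr_ge0 //.
have hp := powR_add1_le _ _ _ _ rho_gt0 rho_le q_ge2 rv0.
have hm := powR_sub1_le _ _ _ _ rho_gt0 rho_le q_ge2 rv0.
(* The choice [r = rho / sqrt q] cancels [rho] and one factor [q]. *)
have e1 : q ^+ 2 * (r * v) ^+ 2 / (2 * rho ^+ 2) = q / 2 * w.
  by rewrite exprMn vw /r expr_div_n sqq; field; lra.
have e2 : powR (noise_scale rho q * (r * v)) q =
    powR (rho * noise_scale rho q / Num.sqrt q) q * powR w (q / 2).
  have K1 := scale_ge1 _ _ _ rho_gt0 rho_le q_ge2.
  rewrite -vw powR_sqr_half (ger0_norm v0) -powRM //.
    by congr powR; rewrite /r; ring.
  by apply: divr_ge0; [apply: mulr_ge0; lra|lra].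
rewrite e1 e2 in hp hm.
case/andP: th01 => th0 th1; have th1' : 0 <= 1 - th by lra.
apply: le_trans (lerD (ler_wpM2l th0 hp) (ler_wpM2l th1' hm)) _.
(* The two bounds differ only in the sign of the linear term, and [(2 * th - 1) * v = u]. *)
set C := _ * powR w _; rewrite -[X in q * r * X]uvK le_eqVlt; apply/orP; left.
by apply/eqP; rewrite /th; move: (u / v) => z; field.
Qed.

(** By homogeneity [alpha] is scaled to [1]; averaging [noise_pointwise] then removes the linear
    term, and Bernoulli handles the rest. *)
Lemma noise_average (R : realType) (I : finType) (mu : I -> R)
  (rho q alpha : R) (u w : I -> R) :
  (forall a, 0 <= mu a) -> \sum_a mu a = 1 ->
  0 < rho -> rho <= 1 / 3 -> 2 <= q -> 0 <= alpha -> (forall a, 0 <= w a) ->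
  (forall a, u a ^+ 2 <= alpha * w a) -> \sum_a mu a * u a = 0 ->
  let r := rho / Num.sqrt q in
  \sum_a mu a * powR (alpha + 2 * r * u a + r ^+ 2 * w a) (q / 2)
  <= powR (alpha + \sum_a mu a * w a) (q / 2)
     + powR (rho * noise_scale rho q / Num.sqrt q) q * \sum_a mu a * powR (w a) (q / 2).
Proof.
move=> mu0 mu1 rho_gt0 rho_le q_ge2 alpha0 w0 uw u_mean.
set r := rho / _; cbv zeta; set c := powR _ q.
have sq0 : 0 < Num.sqrt q by rewrite sqrtr_gt0; lra.
have r0 : 0 < r by rewrite divr_gt0.
have K1 := scale_ge1 _ _ _ rho_gt0 rho_le q_ge2.
have q0 : 0 <= q by lra.
rewrite mulr_sumr; move: alpha0; rewrite le_eqVlt => /orP[/eqP a0|a0].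
  (* [alpha = 0] forces [u = 0], and the claim follows termwise from [r <= rho * K / sqrt q], that
     is, from [K >= 1]. *)
  rewrite -[leLHS]add0r; apply: lerD; first exact: powR_ge0.
  apply: ler_sum => a _; rewrite [leRHS]mulrCA ler_wpM2l //.
  have -> : u a = 0.
    by apply/eqP; rewrite -sqrf_eq0 eq_le sqr_ge0 andbT (le_trans (uw a)) // -a0 mul0r.
  rewrite -a0 mulr0 !add0r powRM ?sqr_ge0 // powR_sqr_half.
  rewrite ler_wpM2r ?powR_ge0 // ger0_norm ?(ltW r0) //.
  have rK : r <= rho * noise_scale rho q / Num.sqrt q.
    by rewrite /r ler_wpM2r ?invr_ge0 ?(ltW sq0) // ler_peMr // ltW.
  by apply: ge0_ler_powR; rewrite // nnegrE ?(le_trans (ltW r0)) // ltW.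
set W := \sum_a mu a * w a; set P := powR alpha (q / 2).
have P0 : 0 <= P := powR_ge0 _ _.
have W0 : 0 <= W by apply: sumr_ge0 => a _; apply: mulr_ge0.
have an0 : alpha != 0 by rewrite gt_eqF.
have main a : powR (alpha + 2 * r * u a + r ^+ 2 * w a) (q / 2) <=
    P + P * q * r / alpha * u a + P * (q / 2) / alpha * w a
    + c * powR (w a) (q / 2).
  have wa0 : 0 <= w a / alpha by rewrite divr_ge0 // ltW.
  have uwa : (u a / alpha) ^+ 2 <= w a / alpha.
    rewrite expr_div_n ler_pdivrMr ?exprn_gt0 //.
    by apply: le_trans (uw a) _; rewrite le_eqVlt; apply/orP; left; apply/eqP; field.
  have := ler_wpM2l P0 (noise_pointwise _ _ _ _ _ rho_gt0 rho_le q_ge2 wa0 uwa).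
  rewrite -/r -/c.
  have -> : P * powR (1 + 2 * r * (u a / alpha) + r ^+ 2 * (w a / alpha)) (q / 2) =
      powR (alpha + 2 * r * u a + r ^+ 2 * w a) (q / 2).
    rewrite -powRM ?(ltW a0) //; first by congr powR; field.
    (* Multiplicativity of [powR] needs a nonnegative base; [uwa] bounds it below by a square. *)
    apply: le_trans (_ : (1 + r * (u a / alpha)) ^+ 2 <= _); first exact: sqr_ge0.
    have := ler_wpM2l (sqr_ge0 r) uwa.
    by move: (u a / alpha) (w a / alpha) => ? ? h; lra.
  have ew : P * powR (w a / alpha) (q / 2) = powR (w a) (q / 2).
    by rewrite -powRM ?(ltW a0) //; congr powR; field.
  move=> /le_trans; apply; rewrite -ew.
  by rewrite le_eqVlt; apply/orP; left; apply/eqP; ring.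
have z0 : 0 <= 1 + W / alpha by rewrite addr_ge0 // divr_ge0 // ltW.
have p1 : 1 <= q / 2 by lra.
have := ler_wpM2l P0 (powR_Bernoulli _ _ _ p1 z0).
rewrite -powRM ?(ltW a0) //.
have -> : alpha * (1 + W / alpha) = alpha + W by field.
rewrite -(lerD2r (\sum_a c * (mu a * powR (w a) (q / 2)))).
apply: le_trans.
apply: le_trans (ler_sum _ (fun a _ => ler_wpM2l (mu0 a) (main a))) _.
(* The total mass [1] and the zero mean of [u] are reinserted so that both sides become sums over
   [a] that agree termwise. *)
have -> : P * (1 + q / 2 * (1 + W / alpha - 1)) =
    P * (\sum_a mu a) + P * q * r / alpha * (\sum_a mu a * u a)
    + P * (q / 2) / alpha * W by rewrite mu1 u_mean; field.
rewrite /W !mulr_sumr -!big_split /= le_eqVlt; apply/orP; left; apply/eqP.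
by apply: eq_bigr => a _; ring.
Qed.

(** The discriminant bound without division: the vectors [(b, -a)] and [(c, -b)] give [a] and [c]
    times [a * c - b ^+ 2], and [(b, -1)] settles [a = c = 0]. *)
Lemma sqr_le_of_quad_ge0 (R : realDomainType) (a b c : R) :
  (forall s t, 0 <= s ^+ 2 * a + 2 * s * t * b + t ^+ 2 * c) -> b ^+ 2 <= a * c.
Proof.
move=> quad.
have := quad 1 0; have := quad 0 1; have := quad b (- a); have := quad c (- b).
rewrite !(expr0n, expr1n, mul0r, mulr0, mul1r, mulr1, add0r, addr0).
move=> h1 h2 c0 a0.
have {}h2 : 0 <= a * (a * c - b ^+ 2) by apply: le_trans h2 _; lra.
have {}h1 : 0 <= c * (a * c - b ^+ 2) by apply: le_trans h1 _; lra.
rewrite -subr_ge0; move: a0; rewrite le_eqVlt => /orP[/eqP a0|a_gt0]; last first.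
  by rewrite pmulr_rge0 in h2.
move: c0; rewrite le_eqVlt => /orP[/eqP c0|c_gt0]; last first.
  by rewrite pmulr_rge0 in h1.
by have := quad b (- 1); rewrite -a0 -c0 => h; nra.
Qed.

(** * Folds of commuting operators *)

Lemma foldr_commute (I : eqType) (T : Type) (op : I -> T -> T) :
  (forall i j z, op i (op j z) = op j (op i z)) ->
  forall i s z, foldr op (op i z) s = op i (foldr op z s).
Proof. by move=> opC i s z; elim: s => //= j s ->. Qed.

Lemma foldr_perm (I : eqType) (T : Type) (op : I -> T -> T) :
  (forall i j z, op i (op j z) = op j (op i z)) ->
  forall s1 s2 z, perm_eq s1 s2 -> foldr op z s1 = foldr op z s2.
Proof.
move=> opC s1 s2 z /catCA_perm_ind P.
apply: (P (fun s => foldr op z s1 = foldr op z s)) => // {P s2} t1 t2 t3 ->.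
rewrite !foldr_cat; elim: t1 (foldr op z t3) => //= i t1 IH y.
by rewrite IH foldr_commute.
Qed.

(** [enum (i |: A)] need not list [i] first, but commutation makes the order irrelevant. *)
Lemma foldr_setU1 (I : finType) (T : Type) (op : I -> T -> T) :
  (forall i j z, op i (op j z) = op j (op i z)) ->
  forall i (A : {set I}) z, i \notin A ->
  foldr op z (enum (i |: A)) = op i (foldr op z (enum A)).
Proof.
move=> opC i A z iA; rewrite -[RHS]/(foldr op z (i :: enum A)).
apply: (foldr_perm _ _ _ opC); apply: uniq_perm => [||j].
- exact: enum_uniq.
- by rewrite /= mem_enum iA enum_uniq.
- by rewrite inE !mem_enum !inE.
Qed.

(** * Averaging and noise operators *)

Section Operators.
Context {R : realType} {Omega : finType} {n : nat}.
Variable mu : Omega -> R.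
Implicit Types (f g h : pt Omega n -> R) (i j : 'I_n) (A J S : {set 'I_n}).

Lemma upd_same i a b (x : pt Omega n) : upd (upd x i a) i b = upd x i b.
Proof. by apply/ffunP => k; rewrite !ffunE; case: eqP. Qed.

Lemma updC i j a b (x : pt Omega n) : i != j ->
  upd (upd x i a) j b = upd (upd x j b) i a.
Proof.
move=> ij; apply/ffunP => k; rewrite !ffunE.
by case: eqP => // ->; rewrite eq_sym (negbTE ij).
Qed.

Lemma upd_id i (x : pt Omega n) : upd x i (x i) = x.
Proof. by apply/ffunP => k; rewrite !ffunE; case: eqP => // ->. Qed.

Lemma EiC i j f : Ei mu i (Ei mu j f) = Ei mu j (Ei mu i f).
Proof.
have [->//|ij] := eqVneq i j; apply/funext => x; rewrite /Ei.
under eq_bigr do rewrite mulr_sumr.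
rewrite exchange_big; apply: eq_bigr => b _; rewrite mulr_sumr.
by apply: eq_bigr => a _; rewrite mulrCA (updC _ _ _ _ _ ij).
Qed.

(* [Li] and the one-coordinate noise operator [Ti] both have this shape. *)
Definition lin (a b : R) i f : pt Omega n -> R := fun x => a * f x + b * Ei mu i f x.

Lemma Li_lin i f : Li mu i f = lin 1 (-1) i f.
Proof. by apply/funext => x; rewrite /lin mul1r mulN1r. Qed.

Lemma Ei_comb i a b f g :
  Ei mu i (fun x => a * f x + b * g x) = fun x => a * Ei mu i f x + b * Ei mu i g x.
Proof.
apply/funext => x; rewrite /Ei !mulr_sumr -big_split; apply: eq_bigr => c _ /=.
by ring.
Qed.

Lemma linC a b c d i j f : lin a b i (lin c d j f) = lin c d j (lin a b i f).
Proof.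
apply/funext => x; rewrite /lin !Ei_comb EiC; set E := Ei mu j (Ei mu i f) x.
by ring.
Qed.

Lemma LiC i j f : Li mu i (Li mu j f) = Li mu j (Li mu i f).
Proof. by rewrite !Li_lin linC. Qed.

Definition Ti (r : R) i f : pt Omega n -> R := lin r (1 - r) i f.

Definition avg A f := foldr (@Ei _ _ mu n) f (enum A).
Definition noise r A f := foldr (Ti r) f (enum A).

Lemma avgU1 i A f : i \notin A -> avg (i |: A) f = Ei mu i (avg A f).
Proof. exact: foldr_setU1 EiC i A f. Qed.

Lemma avg_Ei i A f : avg A (Ei mu i f) = Ei mu i (avg A f).
Proof. exact: foldr_commute EiC i _ f. Qed.

Lemma noiseU1 r i A f : i \notin A -> noise r (i |: A) f = Ti r i (noise r A f).
Proof. by move=> iA; apply: foldr_setU1 => // *; apply: linC. Qed.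

Lemma Li_noise r i A f : Li mu i (noise r A f) = noise r A (Li mu i f).
Proof.
rewrite /noise; elim: (enum A) => //= j s <-.
by rewrite !Li_lin /Ti linC.
Qed.

Lemma LSU1 i S f : i \notin S -> LS mu (i |: S) f = LS mu S (Li mu i f).
Proof.
move=> iS; rewrite /LS (foldr_setU1 _ _ _ LiC) //.
by rewrite (foldr_commute _ _ _ LiC).
Qed.

(** [Ei] and [Ti] both act through a one-coordinate kernel, so a single computation describes the
    folds [avg] and [noise] explicitly. *)
Definition kernel_op (k : Omega -> Omega -> R) i f : pt Omega n -> R :=
  fun x => \sum_a k (x i) a * f (upd x i a).

Lemma foldr_kernel k (s : seq 'I_n) f (x : pt Omega n) : uniq s ->
  foldr (kernel_op k) f s x =
  \sum_(y : pt Omega n) (\prod_i (if i \in s then k (x i) (y i) else (x i == y i)%:R)) * f y.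
Proof.
elim: s x => [|i s IH] x /=.
  move=> _; rewrite (bigD1 x) //= [X in _ + X]big1 ?addr0; last first.
    move=> y yx; have [i xy] : exists i, x i != y i.
      apply/existsP; move: yx; apply: contraNT; rewrite negb_exists => /forallP h.
      by apply/eqP/ffunP => i; apply/esym/eqP; rewrite -[_ == _]negbK; apply: h.
    by rewrite (bigD1 i) //= (negbTE xy) !mul0r.
  by rewrite big1 ?mul1r // => i _; rewrite eqxx.
case/andP=> i_s s_uniq; rewrite {1}/kernel_op.
under eq_bigr do rewrite (IH _ s_uniq) mulr_sumr.
rewrite exchange_big; apply: eq_bigr => y _ /=.
(* As [i] is not in [s], the factor at [i] is an indicator, and only [a = y i] survives. *)
rewrite (bigD1 (y i)) //= [X in _ + X]big1 ?addr0; last first.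
  move=> a ay; rewrite (bigD1 i) //= (negbTE i_s) ffunE eqxx (negbTE ay).
  by rewrite !mul0r mulr0.
rewrite mulrA; congr (_ * _); rewrite [in LHS](bigD1 i) //= [RHS](bigD1 i) //=.
rewrite (negbTE i_s) ffunE !eqxx mul1r inE eqxx /=; congr (_ * _).
by apply: eq_bigr => j ji; rewrite ffunE inE (negbTE ji).
Qed.

Lemma avgE A f (x : pt Omega n) : avg A f x =
  \sum_(y : pt Omega n) (\prod_i (if i \in A then mu (y i) else (x i == y i)%:R)) * f y.
Proof.
rewrite -[LHS]/(foldr (kernel_op (fun _ => mu)) f (enum A) x).
rewrite foldr_kernel ?enum_uniq //.
by apply: eq_bigr => y _; congr (_ * _); apply: eq_bigr => i _; rewrite mem_enum.
Qed.

Lemma noise_setT r f (x : pt Omega n) : noise r setT f x = Trho mu r f x.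
Proof.
pose k b a := r * (b == a)%:R + (1 - r) * mu a.
have -> : noise r setT f = foldr (kernel_op k) f (enum [set: 'I_n]).
  rewrite /noise; elim: (enum _) => //= i s ->; apply/funext => y.
  rewrite /Ti /lin /kernel_op /k /Ei; move: (foldr _ _ _) => g.
  under [RHS]eq_bigr do rewrite mulrDl.
  rewrite big_split /= mulr_sumr; congr (_ + _); last first.
    by apply: eq_bigr => a _; rewrite mulrA.
  rewrite (bigD1 (y i)) //= big1 ?addr0 => [|a ay].
    by rewrite eqxx mulr1 upd_id.
  by rewrite eq_sym (negbTE ay) mulr0 mul0r.
rewrite foldr_kernel ?enum_uniq //; apply: eq_bigr => y _; congr (_ * _).
by apply: eq_bigr => i _; rewrite mem_enum inE.
Qed.

Lemma Emu_avg f (x : pt Omega n) : Emu mu f = avg setT f x.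
Proof.
rewrite avgE; apply: eq_bigr => y _; congr (_ * _).
by apply: eq_big => i; rewrite inE.
Qed.

Lemma avg_comb A a b f g :
  avg A (fun x => a * f x + b * g x) = fun x => a * avg A f x + b * avg A g x.
Proof.
apply/funext => x; rewrite !avgE !mulr_sumr -big_split; apply: eq_bigr => c _ /=.
by ring.
Qed.

Hypothesis mu_ge0 : forall a, 0 <= mu a.
Hypothesis mu_sum1 : \sum_a mu a = 1.

Lemma avg_ge0 A f x : (forall y, 0 <= f y) -> 0 <= avg A f x.
Proof.
move=> f0; rewrite avgE; apply: sumr_ge0 => y _; apply: mulr_ge0 => //.
by apply: prodr_ge0 => i _; case: ifP.
Qed.

Lemma Emu_le f g : (forall x, f x <= g x) -> Emu mu f <= Emu mu g.
Proof.
move=> fg; apply: ler_sum => x _; apply: ler_wpM2l => //.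
by apply: prodr_ge0.
Qed.

Lemma Emu_comb a b f g : Emu mu (fun x => a * f x + b * g x) = a * Emu mu f + b * Emu mu g.
Proof.
rewrite /Emu !mulr_sumr -big_split; apply: eq_bigr => c _ /=.
by ring.
Qed.

Lemma Ei_invariant i f (x : pt Omega n) : (forall a, f (upd x i a) = f x) -> Ei mu i f x = f x.
Proof.
move=> fx; rewrite /Ei; under eq_bigr do rewrite fx.
by rewrite -mulr_suml mu_sum1 mul1r.
Qed.

Lemma Ei_upd i f (x : pt Omega n) a : Ei mu i f (upd x i a) = Ei mu i f x.
Proof. by apply: eq_bigr => b _; rewrite upd_same. Qed.

Lemma Ei_idem i f : Ei mu i (Ei mu i f) = Ei mu i f.
Proof. by apply/funext => x; apply: Ei_invariant => a; apply: Ei_upd. Qed.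

Lemma Emu_Ei i f : Emu mu (Ei mu i f) = Emu mu f.
Proof.
(* [Emu_avg] needs a base point; without one both sums are empty. *)
have [x _|no_pt] := pickP (pt Omega n); last first.
  by rewrite /Emu !big1 // => x; have := no_pt x.
rewrite !(Emu_avg _ x) -(setD1K (in_setT i)) !avgU1 ?setD11 //.
by rewrite avg_Ei Ei_idem.
Qed.

(** The average of [(s * f + t * g) ^+ 2] is a nonnegative quadratic form in [s] and [t]. *)
Lemma avg_cauchy_schwarz A f g (x : pt Omega n) :
  avg A (fun y => f y * g y) x ^+ 2 <=
  avg A (fun y => f y ^+ 2) x * avg A (fun y => g y ^+ 2) x.
Proof.
apply: sqr_le_of_quad_ge0 => s t.
have := @avg_ge0 A (fun y => (s * f y + t * g y) ^+ 2) x (fun y => sqr_ge0 _).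
suff -> : (fun y => (s * f y + t * g y) ^+ 2) =
  (fun y => s ^+ 2 * f y ^+ 2 + 1 * (2 * s * t * (f y * g y) + t ^+ 2 * g y ^+ 2)).
  by rewrite !avg_comb mul1r addrA.
by apply/funext => y; ring.
Qed.

End Operators.

(** * Moment bounds for the noise operator, one coordinate at a time *)

Section NoiseMoments.
Context {R : realType} {Omega : finType} {n : nat}.
Variable mu : Omega -> R.
Hypotheses (mu_ge0 : forall a, 0 <= mu a) (mu_sum1 : \sum_a mu a = 1).
Implicit Types (f : pt Omega n -> R) (i : 'I_n) (A J S : {set 'I_n}).

Lemma avg_Ei_sqr i A f (x : pt Omega n) b :
  avg mu A (fun y => Ei mu i f y ^+ 2) (upd x i b) = avg mu A (fun y => Ei mu i f y ^+ 2) x.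
Proof.
have -> : (fun y => Ei mu i f y ^+ 2) = Ei mu i (fun y => Ei mu i f y ^+ 2).
  apply/funext => y; apply/esym/Ei_invariant => // a.
  by rewrite Ei_upd.
by rewrite avg_Ei Ei_upd.
Qed.

(** After commuting the averages, [Ei mu i f] is constant in coordinate [i] and factors out, leaving
    [Ei] of [Li], which vanishes. *)
Lemma Ei_avg_mulEL i A f (x : pt Omega n) :
  Ei mu i (avg mu A (fun y => Ei mu i f y * Li mu i f y)) x = 0.
Proof.
rewrite -avg_Ei avgE big1 // => y _; apply/eqP; rewrite mulf_eq0; apply/orP; right.
apply/eqP; rewrite /Ei -/(Ei mu i f _).
under eq_bigr do rewrite -/(Ei mu i f _) Ei_upd mulrCA.
rewrite -mulr_sumr -/(Ei mu i (Li mu i f) y) Li_lin /lin Ei_comb Ei_idem //.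
by rewrite mul1r mulN1r subrr mulr0.
Qed.

Lemma noise_step (rho q : R) i A f :
  0 < rho -> rho <= 1 / 3 -> 2 <= q -> i \notin A ->
  Emu mu (fun x => powR (avg mu A (fun y => Ti mu (rho / Num.sqrt q) i f y ^+ 2) x) (q / 2))
  <= Emu mu (fun x => powR (avg mu (i |: A) (fun y => f y ^+ 2) x) (q / 2))
     + powR (rho * noise_scale rho q / Num.sqrt q) q
       * Emu mu (fun x => powR (avg mu A (fun y => Li mu i f y ^+ 2) x) (q / 2)).
Proof.
move=> rho_gt0 rho_le q_ge2 iA; set r := rho / _; set c := powR _ q.
(* An extra average over coordinate [i] in the left side and in the [c] term makes the inequality
   pointwise in [x]; the middle term already averages over [i]. *)
rewrite -(Emu_Ei _ mu_sum1 i) -[X in c * X](Emu_Ei _ mu_sum1 i).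
rewrite -[Emu mu _ as X in _ <= X + _]mul1r -Emu_comb; apply: Emu_le => // x.
rewrite mul1r.
pose a := Ei mu i f; pose h := Li mu i f.
pose alpha := avg mu A (fun y => a y ^+ 2) x.
pose u b := avg mu A (fun y => a y * h y) (upd x i b).
pose w b := avg mu A (fun y => h y ^+ 2) (upd x i b).
have u_mean : \sum_b mu b * u b = 0 by exact: Ei_avg_mulEL.
(* Used with [s = r] for [Ti] applied to [f] and with [s = 1] for [f] itself. *)
have expand s b : avg mu A (fun y => (a y + s * h y) ^+ 2) (upd x i b) =
    alpha + 2 * s * u b + s ^+ 2 * w b.
  have -> : (fun y => (a y + s * h y) ^+ 2) =
      fun y => 1 * (1 * a y ^+ 2 + 2 * s * (a y * h y)) + s ^+ 2 * h y ^+ 2.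
    by apply/funext => y; ring.
  by rewrite !avg_comb avg_Ei_sqr /u /w !mul1r.
have Ti_ah y : Ti mu r i f y = a y + r * h y by rewrite /Ti /lin /h /Li -/a; ring.
have f_ah y : f y = a y + 1 * h y by rewrite /h /Li -/a; ring.
rewrite [leLHS](_ : _ = \sum_b mu b * powR (alpha + 2 * r * u b + r ^+ 2 * w b) (q / 2)).
  rewrite [X in powR X _ + _](_ : _ = alpha + \sum_b mu b * w b).
    apply: noise_average => //.
    - by apply: avg_ge0 => // y; apply: sqr_ge0.
    - by move=> b; apply: avg_ge0 => // y; apply: sqr_ge0.
    - move=> b; rewrite /alpha -(avg_Ei_sqr i A f x b).
      exact: avg_cauchy_schwarz.
  rewrite avgU1 // (_ : (fun y => f y ^+ 2) = fun y => (a y + 1 * h y) ^+ 2); last first.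
    by apply/funext => y; rewrite f_ah.
  rewrite {1}/Ei; under eq_bigr do rewrite expand expr1n mul1r mulr1 2!mulrDr mulrCA.
  by rewrite !big_split /= -mulr_suml mu_sum1 mul1r -mulr_sumr u_mean mulr0 addr0.
apply: eq_bigr => b _; congr (_ * powR _ _); rewrite -expand.
by congr avg; apply/funext => y; rewrite Ti_ah.
Qed.

(** Pairing [S] with [i |: S] matches the two terms of [noise_step]. *)
Lemma sum_subset_setD1 (V : nmodType) i A (F : {set 'I_n} -> V) : i \in A ->
  \sum_(S : {set 'I_n} | S \subset A) F S =
  \sum_(S : {set 'I_n} | S \subset A :\ i) (F S + F (i |: S)).
Proof.
move=> iA; rewrite (bigID (fun S : {set 'I_n} => i \in S)) big_split /=.
rewrite addrC; congr (_ + _); first by apply: eq_bigl => S; rewrite subsetD1.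
rewrite (reindex_onto (fun S : {set 'I_n} => i |: S) (fun S => S :\ i)) /=; last first.
  by move=> S /andP[_ iS]; rewrite setD1K.
apply: eq_bigl => S; rewrite setU11 andbT subUset sub1set iA /= subsetD1; congr (_ && _).
apply/eqP/idP => [<-|iS]; first by rewrite setD11.
by rewrite setU1K.
Qed.

(** Induction on [#|J|], with [A] collecting the coordinates already averaged. For [i] in [J], the
    first term of [noise_step] moves [i] into [A]; the second replaces [f] by [Li mu i f], puts [i]
    into [S] and costs one factor [c]. *)
Lemma noise_moment (rho q : R) A J f :
  0 < rho -> rho <= 1 / 3 -> 2 <= q -> [disjoint A & J] ->
  Emu mu (fun x => powR (avg mu A (fun y => noise mu (rho / Num.sqrt q) J f y ^+ 2) x) (q / 2))
  <= \sum_(S : {set 'I_n} | S \subset J)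
       powR (rho * noise_scale rho q / Num.sqrt q) q ^+ #|S|
       * Emu mu (fun x => powR (avg mu (A :|: (J :\: S)) (fun y => LS mu S f y ^+ 2) x) (q / 2)).
Proof.
move=> rho_gt0 rho_le q_ge2; set r := rho / _; set c := powR _ q.
have c0 : 0 <= c by exact: powR_ge0.
move: {2}#|J| (erefl #|J|) => k; elim: k J A f => [|k IH] J A f.
  move/eqP; rewrite cards_eq0 => /eqP -> _.
  rewrite (big_pred1 set0) => [|S]; last by rewrite subset0.
  by rewrite cards0 mul1r set0D setU0 /noise /LS enum_set0.
move=> J_card; have /card_gt0P[i iJ] : (0 < #|J|)%N by rewrite J_card.
move=> AJ; have iA : i \notin A by rewrite (disjointFl AJ).
have J'_card : #|J :\ i| = k by move: J_card; rewrite (cardsD1 i) iJ => -[].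
have AJ' : [disjoint A & J :\ i] by apply: disjointWr AJ; apply: subD1set.
have iAJ' : [disjoint i |: A & J :\ i].
  by rewrite -setI_eq0 setIUl setU_eq0 !setI_eq0 disjoints1 setD11.
rewrite -{1}(setD1K iJ) noiseU1 ?setD11 // (sum_subset_setD1 _ i) // big_split /=.
apply: le_trans (noise_step _ _ _ _ _ rho_gt0 rho_le q_ge2 iA) _.
rewrite Li_noise -/c; apply: lerD.
  apply: le_trans (IH _ _ _ J'_card iAJ') _; rewrite le_eqVlt; apply/orP; left; apply/eqP.
  apply: eq_bigr => S; rewrite subsetD1 => /andP[_ iS]; congr (_ * Emu _ _).
  apply/funext => x; congr (powR (avg _ _ _ _) _).
  apply/setP => j; rewrite !inE; have [->|_] := eqVneq j i; last by [].
  by rewrite iJ iS orbT.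
apply: le_trans (ler_wpM2l c0 (IH _ _ _ J'_card AJ')) _.
rewrite mulr_sumr le_eqVlt; apply/orP; left; apply/eqP.
apply: eq_bigr => S; rewrite subsetD1 => /andP[_ iS].
rewrite cardsU1 iS /= exprS mulrA LSU1 //; congr (_ * Emu _ _).
apply/funext => x; congr (powR (avg _ _ _ _) _).
by rewrite setDDl.
Qed.

End NoiseMoments.

(** * Splitting the coordinates along S *)

Section Split.
Context {R : realType} {Omega : finType} {n : nat}.
Variable S : {set 'I_n}.
Implicit Types (x : ptIn Omega S) (y : ptOut Omega S) (z : pt Omega n).

(* The match is generalized over the index of [alt_spec] only: [F] and [G] must
   keep seeing [b]. *)
Lemma match_boolP (T : Type) (b : bool) (F : b -> T) (G : ~~ b -> T) (c : bool)
  (a : alt_spec b b c) :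
  (forall h, match a with AltTrue h' => F h' | AltFalse h' => G h' end = F h)
  /\ (forall h, match a with AltTrue h' => F h' | AltFalse h' => G h' end = G h).
Proof.
case: a => h'; split=> h.
- by rewrite (bool_irrelevance h' h).
- by case: (negP h).
- by case: (negP h').
- by rewrite (bool_irrelevance h' h).
Qed.

Lemma merge_in x y i (iS : i \in S) : Defs.merge x y i = x (exist _ i iS).
Proof.
rewrite ffunE.
exact: (match_boolP _ _ (fun h => x (exist _ i h)) (fun h => y (exist _ i h)) _ (boolP _)).1.
Qed.

Lemma merge_out x y i (iS : i \notin S) : Defs.merge x y i = y (exist _ i iS).
Proof.
rewrite ffunE.
exact: (match_boolP _ _ (fun h => x (exist _ i h)) (fun h => y (exist _ i h)) _ (boolP _)).2.
Qed.

Definition restr_in z : ptIn Omega S := [ffun i => z (val i)].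
Definition restr_out z : ptOut Omega S := [ffun i => z (val i)].

Lemma mergeK z : Defs.merge (restr_in z) (restr_out z) = z.
Proof.
apply/ffunP => i; have [iS|iS] := boolP (i \in S).
  by rewrite merge_in ffunE.
by rewrite merge_out ffunE.
Qed.

Lemma restr_inK x y : restr_in (Defs.merge x y) = x.
Proof. by apply/ffunP => -[i iS]; rewrite ffunE merge_in. Qed.

Lemma restr_outK x y : restr_out (Defs.merge x y) = y.
Proof. by apply/ffunP => -[i iS]; rewrite ffunE merge_out. Qed.

Lemma sum_merge (F : pt Omega n -> R) :
  \sum_z F z = \sum_(x : ptIn Omega S) \sum_(y : ptOut Omega S) F (Defs.merge x y).
Proof.
rewrite pair_bigA.
rewrite (reindex (fun p : ptIn Omega S * ptOut Omega S => @Defs.merge Omega n S p.1 p.2)) //=.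
exists (fun z => (restr_in z, restr_out z)) => [[x y]|z] _ /=.
  by rewrite restr_inK restr_outK.
exact: mergeK.
Qed.

Lemma prod_merge (F : 'I_n -> Omega -> R) x y :
  \prod_i F i (Defs.merge x y i) =
  (\prod_(i : {i : 'I_n | i \in S}) F (val i) (x i))
  * \prod_(i : {i : 'I_n | i \notin S}) F (val i) (y i).
Proof.
rewrite (bigID (mem S)) /=; congr (_ * _).
  rewrite (big_sub (mem S)); apply: eq_bigr => -[i iS] _ /=.
  by rewrite merge_in.
rewrite (big_sub [pred i | i \notin S]); apply: eq_bigr => -[i iS] _ /=.
by rewrite merge_out.
Qed.

Variable mu : Omega -> R.
Hypothesis mu_sum1 : \sum_a mu a = 1.

(** In [avgE] the factors at coordinates of [S] are indicators, so only points agreeing with [z] on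
    [S] contribute. *)
Lemma avg_setC (h : pt Omega n -> R) z : avg mu (~: S) h z =
  \sum_(y : ptOut Omega S) (\prod_(i : {i : 'I_n | i \notin S}) mu (y i))
  * h (Defs.merge (restr_in z) y).
Proof.
rewrite avgE sum_merge (bigD1 (restr_in z)) //= [X in _ + X]big1 ?addr0; last first.
  move=> x xz; rewrite big1 // => y _.
  have [i zx] : exists i, z (val i) != x i.
    apply/existsP; move: xz; apply: contraNT; rewrite negb_exists => /forallP e.
    apply/eqP/ffunP => i; rewrite ffunE; apply/esym/eqP.
    by rewrite -[_ == _]negbK; apply: e.
  rewrite (bigD1 (val i)) //= inE (valP i) /= -[RHS](mul0r (h (Defs.merge x y))).
  congr (_ * _); case: i zx => i iS /= zx; rewrite (merge_in _ _ _ iS).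
  by rewrite (negbTE zx) mul0r.
apply: eq_bigr => y _; congr (_ * _).
rewrite (prod_merge (fun i a => if i \in ~: S then mu a else (z i == a)%:R)).
rewrite big1 => [|[i iS] _]; last by rewrite /= inE iS /= ffunE eqxx.
by rewrite mul1r; apply: eq_bigr => -[i iS] _ /=; rewrite inE iS.
Qed.

(** The average over [~: S] depends on [z] only through its part in [S], so the other coordinates
    integrate to their total mass [1]. *)
Lemma EIn_avg_setC (h : pt Omega n -> R) (G : R -> R) :
  EIn mu (fun x : ptIn Omega S =>
    G (\sum_(y : ptOut Omega S)
         (\prod_(i : {i : 'I_n | i \notin S}) mu (y i)) * h (Defs.merge x y)))
  = Emu mu (fun z => G (avg mu (~: S) h z)).
Proof.
rewrite /Emu sum_merge; apply: eq_bigr => x _.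
under [RHS]eq_bigr => y _.
  rewrite avg_setC restr_inK (_ : wt mu setT _ = \prod_i mu (Defs.merge x y i)); last first.
    by apply: eq_bigl => i; rewrite inE.
  rewrite (prod_merge (fun _ => mu)) mulrAC; over.
(* That mass is, by distributivity, a product of sums of [mu]. *)
rewrite -mulr_sumr -(bigA_distr_bigA (fun _ => mu)) [X in _ = _ * X]big1 ?mulr1 //.
Qed.

End Split.

Theorem mainTheorem11 (R : realType) (Omega : finType) (mu : Omega -> R)
  (mu_ge0 : forall a, 0 <= mu a) (mu_sum1 : \sum_(a : Omega) mu a = 1)
  (n : nat) (rho q : R) (rho_gt0 : 0 < rho) (rho_le : rho <= 1 / 3) (q_ge2 : 2 <= q)
  (f : pt Omega n -> R) :
  let beta := rho * (1 + 2 * (q - 2) / ln (1 / rho)) in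
  Emu mu (fun x => powR `|Trho mu (rho / Num.sqrt q) f x| q)
  <= \sum_(S : {set 'I_n})
       powR beta (q * #|S|%:R) * powR q (- (q * #|S|%:R) / 2)
       * @EIn R Omega mu n S (fun x => powR (@norm2Out R Omega mu n S (@DS R Omega mu n S x f)) q).
Proof.
cbv zeta; rewrite -/(noise_scale rho q).
have disj : [disjoint set0 & [set: 'I_n]] by rewrite -setI_eq0 set0I.
have := noise_moment _ mu_ge0 mu_sum1 _ _ _ _ f rho_gt0 rho_le q_ge2 disj.
set lhs := Emu _ _; set rhs := \sum_(S | _) _.
(* Averaging over [set0] is the identity, so the square raised to [q / 2] is the [q]-th power of the
   absolute value. *)
have -> : lhs = Emu mu (fun x => powR `|Trho mu (rho / Num.sqrt q) f x| q).
  congr Emu; apply/funext => x; rewrite /avg enum_set0 /= powR_sqr_half.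
  by rewrite noise_setT.
move=> /le_trans; apply; rewrite le_eqVlt; apply/orP; left; apply/eqP.
apply: eq_big => [S|S _]; first by rewrite subsetT.
have q0 : 0 < q by lra.
have K1 := scale_ge1 _ _ _ rho_gt0 rho_le q_ge2.
have b0 : 0 <= rho * noise_scale rho q by apply: mulr_ge0; lra.
congr (_ * _).
  (* Written as a power of [1 / sqrt q], this factor merges with that of [beta] into the constant of
     [noise_moment] raised to [#|S|]. *)
  have -> : powR q (- (q * #|S|%:R) / 2) = powR (powR (Num.sqrt q)^-1 q) #|S|%:R.
    rewrite -powR12_sqrt ?(ltW q0) // -powRN -!powRrM.
    by congr powR; field.
  rewrite powRrM -powRM ?powR_ge0 // -powRM //; last by rewrite invr_ge0 sqrtr_ge0.
  by rewrite powR_mulrn // powR_ge0.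
rewrite set0U setTD.
apply: etrans (esym (EIn_avg_setC S mu mu_sum1 (fun z => LS mu S f z ^+ 2)
                       (fun t => powR t (q / 2)))) _.
congr EIn; apply/funext => x.
rewrite /norm2Out -[X in _ = powR X q]ger0_norm ?sqrtr_ge0 // -powR_sqr_half.
rewrite sqr_sqrtr //; apply: sumr_ge0 => y _; rewrite mulr_ge0 ?sqr_ge0 //.
by apply: prodr_ge0.
Qed.
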